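(* Let $H$ be a complex Hilbert space. The set $GL_{S}^{+}(H)$ of positive isomorphisms in $L(H)$ is convex; that is, if $L,T\in GL_{S}^{+}(H)$, then $tL+(1-t)T\in GL_{S}^{+}(H)$ for every $t\in[0,1]$.
   Context: $L(H)$ is the Banach space of bounded linear operators $H\to H$. An operator $L\in L(H)$ is an isomorphism if it is bijective with bounded inverse. A self-adjoint operator $L\in L(H)$ is called positive if $\langle Lx,x\rangle>0$ for all $x\in H$ with $\Vert x\Vert=1$. $GL_{S}^{+}(H)$ denotes the set of $L\in L(H)$ that are self-adjoint, positive and isomorphisms. *)

(* Defs.v *)
From HB Require Import structures.
From mathcomp Require Import all_boot all_order all_algebra.
From mathcomp Require Import complex.
From mathcomp Require Import all_classical all_reals all_analysis.

Set Implicit Arguments.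
Unset Strict Implicit.
Unset Printing Implicit Defensive.

Import Order.TTheory GRing.Theory Num.Theory.
Import numFieldNormedType.Exports.

Local Open Scope classical_set_scope.
Local Open Scope ring_scope.
Local Open Scope complex_scope.

(* [inner] is linear in its first and conjugate-linear in its second argument.
   Norms are valued in [R[i]], whose order is partial: [x <= y] holds when
   [y - x] is a nonnegative real number. *)
HB.mixin Record CompleteNormedModule_isHilbert (R : realType) H
    & CompleteNormedModule R[i] H := {
  inner : {dot H for @Num.conj R[i]};
  inner_normE : forall x : H, inner x x = `|x| ^+ 2
}.

#[short(type="complexHilbertType")]
HB.structure Definition ComplexHilbert (R : realType) :=
  {H of CompleteNormedModule R[i] H & CompleteNormedModule_isHilbert R H}.

Section Operators.
Variables (R : realType) (H : complexHilbertType R).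

(* Stated for arbitrary maps so that it applies to the inverse of an operator. *)
Definition bounded_map (f : H -> H) : Prop :=
  exists M : R, forall x, `|f x| <= M%:C * `|x|.

Definition isomorphism (L : {linear H -> H}) : Prop :=
  exists S : H -> H, [/\ cancel L S, cancel S L & bounded_map S].

Definition is_adjoint (L L' : {linear H -> H}) : Prop :=
  forall x y : H, inner (L x) y = inner x (L' y).

Definition self_adjoint (L : {linear H -> H}) : Prop := is_adjoint L L.

(* Strict positivity in [R[i]] includes being a real number, which is automatic
   for the quadratic form of a self-adjoint operator. *)
Definition positive (L : {linear H -> H}) : Prop :=
  forall x : H, `|x| = 1 -> 0 < inner (L x) x.

Definition GLSp : set {linear H -> H} :=
  [set L : {linear H -> H} |
    [/\ bounded_map L, self_adjoint L, positive L & isomorphism L]].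

End Operators.

Arguments GLSp {R} H.

(* Main.v *)
Require Import Defs.
From HB Require Import structures.
From mathcomp Require Import all_boot all_order all_algebra.
From mathcomp Require Import complex.
From mathcomp Require Import all_classical all_reals all_analysis.
From mathcomp Require Import ring lra.

Set Implicit Arguments.
Unset Strict Implicit.
Unset Printing Implicit Defensive.

Import Order.TTheory GRing.Theory Num.Theory.
Import numFieldNormedType.Exports.

Local Open Scope ring_scope.
Local Open Scope complex_scope.

(** The point is to replace positive definiteness and invertibility by one
condition that is visibly preserved by convex combinations. A bounded
self-adjoint operator A belongs to the set [GLSp H] if and only if it is
coercive: there is c > 0 with c |x|^2 <= <A x, x> for all x. Given this,
if L and T are coercive with constants c and d, then t L + (1 - t) T is
coercive with constant min(c, d), while boundedness and self-adjointness pass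
to linear combinations with real coefficients.

For both directions the key is the estimate |A x|^2 <= M <A x, x>, valid when
A is self-adjoint, has nonnegative form and norm at most M
([sqr_image_le_form]).

A positive isomorphism is coercive ([GLSp_coercive]): if K bounds the inverse
of A, then |x|^2 <= K^2 |A x|^2 <= K^2 M <A x, x>.

A coercive operator is an isomorphism ([coercive_isomorphism]): coercivity
bounds A from below, hence A is injective and any inverse is bounded. For
surjectivity one solves A x = y by finding a fixed point of
x |-> x + (y - A x) / M. The key estimate gives
|w - A w / M|^2 <= |w|^2 - <A w, w> / M <= (1 - c / M) |w|^2, so this map is a
contraction of the complete space H.

The norm of H takes its values in R[i], whose order is partial; the estimates
are therefore carried out with the real inner product Re <x, y>, whose
quadratic form is the square of the norm. *)

(** * Contractions of a complex Banach space *)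

Section FixedPoint.
Variables (R : realType) (X : completeNormedModType R[i]).

(** Banach's fixed point theorem for a norm with values in R[i]. The constant
q is real, so that the decay of its powers can be taken from R. *)
Lemma lipschitz_lt1_fixed_point (f : X -> X) (q : R) :
    0 <= q -> q < 1 -> (forall x y, `|f x - f y| <= q%:C * `|x - y|) ->
  exists p, f p = p.
Proof.
move=> q0 q1 fq; pose y n := iter n f 0.
have qC0 : 0 <= q%:C :> R[i] by rewrite ler0c.
have q1C : 0 < (1 - q)%:C :> R[i] by rewrite ltcR subr_gt0.
pose a := `|f 0| / (1 - q)%:C.
have a0 : 0 <= a by rewrite divr_ge0 // ltW.
(* [a] is the radius of a ball around 0 that [f] maps into itself. *)
have aq : a = `|f 0| + q%:C * a.
  have aE : a * (1 - q)%:C = `|f 0| by rewrite divfK// gt_eqF.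
  by rewrite -aE rmorphB rmorph1; ring.
have near0 m : `|y m| <= a.
  elim: m => [|m IH]; first by rewrite normr0.
  rewrite aq -[y m.+1](subrK (f 0)) addrC (le_trans (ler_normD _ _))// lerD2l.
  by rewrite (le_trans (fq _ _))// subr0 ler_wpM2l.
have dist n m : `|y n - y (n + m)%N| <= q%:C ^+ n * a.
  elim: n => [|n IH]; first by rewrite expr0 mul1r add0n sub0r normrN.
  rewrite addSn (le_trans (fq _ _))// exprS -mulrA ler_wpM2l//.
have small (e : R[i]) : 0 < e -> exists N, q%:C ^+ N * a < e.
  move=> e0; have [e' eE] : exists e', e = e'%:C.
    by apply/complex_realP; rewrite realE ltW.
  have [a' aE] : exists a', a = a'%:C by apply/complex_realP; rewrite realE a0.
  move: e0 a0; rewrite eE aE ltcR ler0c => e0 a'0.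
  have : (geometric a' q @ \oo --> (0 : R))%classic.
    by apply: cvg_geometric; rewrite ger0_norm.
  move=> /cvgrPdist_lt /(_ _ e0) [N _ /(_ N (leqnn N))] /=.
  rewrite sub0r normrN ger0_norm ?mulr_ge0 ?exprn_ge0// => h.
  by exists N; rewrite -rmorphXn -rmorphM ltcR mulrC.
have cy : cvgn y.
  apply/cauchy_cvgP; apply: cauchy_exP => e e0.
  have [N hN] := small e e0.
  exists (y N); exists N => // n /= Nn; rewrite -ball_normE /=.
  by rewrite (le_lt_trans _ hN)// -(subnKC Nn) dist.
exists (limn y).
apply/eqP; rewrite -subr_eq0 -normr_le0; apply/ler_addgt0Pr => e e0; rewrite add0r.
have e20 : 0 < e / 2 by rewrite divr_gt0.
have /cvgrPdist_lt /(_ _ e20) [N _ hN] := cy.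
have h1 := hN N (leqnn N); have h2 := hN N.+1 (leqnSn N).
rewrite -(subrK (y N.+1) (f _)) -addrA (le_trans (ler_normD _ _))//.
rewrite [e]splitr lerD//; last by rewrite distrC ltW.
rewrite (le_trans (fq _ _))// (le_trans _ (ltW h1))//.
by rewrite ler_piMl// -(rmorph1 (real_complex R)) lecR ltW.
Qed.

End FixedPoint.

(** * The real inner product and quadratic forms *)

Section Forms.
Variables (R : realType) (H : complexHilbertType R).
Implicit Types (x y z : H) (A : {linear H -> H}).

Definition rdot x y : R := complex.Re (inner x y).

Lemma innerC x y : inner x y = (inner y x)^*%C.
Proof. by rewrite (hermC inner) expr0 mul1r. Qed.

Lemma rdotC x y : rdot x y = rdot y x.
Proof. by rewrite /rdot innerC; case: (inner y x). Qed.

Lemma rdotDl x y z : rdot (x + y) z = rdot x z + rdot y z.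
Proof. by rewrite /rdot linearDl raddfD. Qed.

Lemma rdotZl (a : R) x y : rdot (a%:C *: x) y = a * rdot x y.
Proof.
rewrite /rdot linearZl_LR.
have ReZ (z : R[i]) : complex.Re (a%:C * z) = a * complex.Re z.
  by case: z => u v /=; rewrite mul0r subr0.
exact: ReZ.
Qed.

Lemma rdotDr x y z : rdot z (x + y) = rdot z x + rdot z y.
Proof. by rewrite rdotC rdotDl !(rdotC z). Qed.

Lemma rdotZr (a : R) x y : rdot x (a%:C *: y) = a * rdot x y.
Proof. by rewrite rdotC rdotZl rdotC. Qed.

Lemma sqr_normE x : `|x| ^+ 2 = (rdot x x)%:C.
Proof.
by rewrite -inner_normE /rdot RRe_real// inner_normE realE exprn_ge0.
Qed.

Lemma rdot_ge0 x : 0 <= rdot x x.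
Proof. by rewrite -ler0c -sqr_normE exprn_ge0. Qed.

Lemma norm_le_rdot (M : R) x y : 0 <= M ->
  (`|x| <= M%:C * `|y|) = (rdot x x <= M ^+ 2 * rdot y y).
Proof.
move=> M0; rewrite -(@ler_pXn2r _ 2)// ?nnegrE ?mulr_ge0 ?ler0c//.
by rewrite exprMn !sqr_normE -rmorphXn -rmorphM lecR.
Qed.

(** The bound can be enlarged at will; [b] lets it dominate a coercivity
constant, which is not automatic when H is trivial. *)
Lemma bounded_map_rdot (f : H -> H) (b : R) : bounded_map f ->
  exists M : R, [/\ 0 < M, b <= M & forall x, rdot (f x) (f x) <= M ^+ 2 * rdot x x].
Proof.
move=> [M hM]; exists (`|M| + `|b| + 1).
have := ler_norm b; have := normr_ge0 b; have := normr_ge0 M => M0 b0 bb.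
split; [lra|lra|move=> x].
rewrite -norm_le_rdot; last lra.
apply: (le_trans (hM x)); rewrite ler_wpM2r// lecR.
have := ler_norm M; lra.
Qed.

Definition coercive A :=
  exists2 c : R, 0 < c & forall x, c * rdot x x <= rdot (A x) x.

Lemma positive_form_ge0 A x : positive A -> 0 <= rdot (A x) x.
Proof.
move=> pA; have [->|x0] := eqVneq x 0.
  by rewrite linear0 /rdot linear0l.
have nx : 0 < rdot x x by rewrite -ltcR -sqr_normE exprn_gt0// normr_gt0.
pose r := (Num.sqrt (rdot x x))^-1.
have r0 : 0 < r by rewrite invr_gt0 sqrtr_gt0.
have /pA : `|r%:C *: x| = 1.
  apply/eqP; rewrite -(@eqrXn2 _ 2)// sqr_normE expr1n rdotZl rdotZr mulrA -expr2.
  by rewrite /r exprVn sqr_sqrtr ?(ltW nx)// mulVf ?(gt_eqF nx)// rmorph1.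
have -> : A (r%:C *: x) = r%:C *: A x by exact: linearZ.
rewrite ltcE => /andP[_]; rewrite -/(rdot _ _) rdotZl rdotZr.
by move=> /ltW; rewrite !pmulr_rge0.
Qed.

(** Evaluating the form at w = x - A x / M gives
0 <= <A x, x> - 2 |A x|^2 / M + <A (A x), A x> / M^2, and the last term is at
most |A x|^2 / M. This replaces the Cauchy-Schwarz inequality for the form
of A, applied to x and A x. *)
Lemma sqr_image_le_form A (M : R) : self_adjoint A ->
    0 < M -> (forall x, rdot (A x) (A x) <= M ^+ 2 * rdot x x) ->
    (forall x, 0 <= rdot (A x) x) ->
  forall x, rdot (A x) (A x) <= M * rdot (A x) x.
Proof.
move=> sA M0 bA pA x.
(* From 0 <= |A u - M u|^2 and |A u| <= M |u|. *)
have up u : rdot (A u) u <= M * rdot u u.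
  have := rdot_ge0 (A u + (- M)%:C *: u).
  rewrite !(rdotDl, rdotDr, rdotZl, rdotZr) (rdotC u (A u)) => h.
  rewrite -(ler_pM2l M0); have := bA u; nra.
(* This is M w, which avoids dividing by M. *)
have := pA (M%:C *: x + (-1)%:C *: A x).
rewrite linearD !linearZ/= !(rdotDl, rdotDr, rdotZl, rdotZr).
have -> : rdot (A (A x)) x = rdot (A x) (A x) by rewrite /rdot sA.
have := up (A x) => h1 h2; rewrite -(ler_pM2l M0); nra.
Qed.

(** * Positive isomorphisms are the coercive self-adjoint operators *)

Lemma GLSp_coercive A : GLSp H A -> coercive A.
Proof.
move=> [bA sA pA [S [AK _ bS]]].
have [M [M0 _ hM]] := bounded_map_rdot 0 bA.
have [K [K0 _ hK]] := bounded_map_rdot 0 bS.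
have MK : 0 < K ^+ 2 * M by rewrite mulr_gt0// exprn_gt0.
exists (K ^+ 2 * M)^-1 => [|x]; first by rewrite invr_gt0.
rewrite ler_pdivrMl//.
have := hK (A x); rewrite AK => /le_trans; apply.
rewrite -[K ^+ 2 * M * _]mulrA; apply: ler_wpM2l; first by rewrite exprn_ge0// ltW.
by apply: sqr_image_le_form => // u; exact: positive_form_ge0.
Qed.

(** Self-adjointness enters through [sqr_image_le_form], which makes 1 / M an
admissible step for the iteration x |-> x + (y - A x) / M. *)
Lemma coercive_isomorphism A :
  bounded_map A -> self_adjoint A -> coercive A -> isomorphism A.
Proof.
move=> bA sA [c c0 cA].
have [M [M0 cM hM]] := bounded_map_rdot c bA.
have pA x : 0 <= rdot (A x) x.
  by apply: le_trans (cA x); rewrite mulr_ge0 ?rdot_ge0 ?ltW.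
have imA := sqr_image_le_form sA M0 hM pA.
(* From 0 <= |A x - c x|^2 and coercivity, without Cauchy-Schwarz. *)
have lowA x : c ^+ 2 * rdot x x <= rdot (A x) (A x).
  have := rdot_ge0 (A x + (- c)%:C *: x).
  rewrite !(rdotDl, rdotDr, rdotZl, rdotZr) (rdotC x (A x)) => h.
  have := cA x; rewrite -(ler_pM2l c0) => h'; nra.
have surj y : exists x, A x = y.
  (* 1 - c / M bounds the square of the Lipschitz constant, and it is at most
     q ^+ 2: this choice of q saves a square root. *)
  pose q := 1 - c / (2 * M).
  have cM0 : 0 < c / (2 * M) by rewrite divr_gt0// mulr_gt0.
  have cM1 : c / (2 * M) < 1 by rewrite ltr_pdivrMr ?mul1r ?mulr_gt0//; lra.
  have [|||p] := @lipschitz_lt1_fixed_point R H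
      (fun x => x + (M^-1)%:C *: (y - A x)) q.
  - by rewrite /q; lra.
  - by rewrite /q; lra.
  - move=> u v; rewrite norm_le_rdot; last by rewrite /q; lra.
    have -> : u + (M^-1)%:C *: (y - A u) - (v + (M^-1)%:C *: (y - A v))
       = (u - v) + (- M^-1)%:C *: A (u - v).
      have -> : A (u - v) = A u - A v by exact: linearB.
      rewrite (rmorphN (real_complex R)) scaleNr -scalerN opprB opprD addrACA.
      by rewrite -scalerN -scalerDr opprB [y - A u + _]addrC subrKA.
    move: (u - v) => w; rewrite !(rdotDl, rdotDr, rdotZl, rdotZr) (rdotC w (A w)).
    have h1 : M^-1 * (M^-1 * rdot (A w) (A w)) <= M^-1 * rdot (A w) w.
      by apply: ler_wpM2l; rewrite ?ler_pdivrMl// invr_ge0 ltW.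
    have h2 : M^-1 * (c * rdot w w) <= M^-1 * rdot (A w) w.
      by apply: ler_wpM2l; rewrite // invr_ge0 ltW.
    have -> : q = 1 - M^-1 * c / 2 by rewrite /q; field; rewrite gt_eqF.
    have := mulr_ge0 (sqr_ge0 (M^-1 * c)) (rdot_ge0 w); lra.
  - move=> pE; have /eqP : (M^-1)%:C *: (y - A p) = 0.
      by apply: (addrI p); rewrite pE addr0.
    rewrite scaler_eq0.
    rewrite (fmorph_eq0 (real_complex R)) invr_eq0 gt_eqF//= subr_eq0 => /eqP ->.
    by exists p.
have [S SK] := choice surj.
exists S; split => //.
- move=> x; apply/eqP; rewrite -subr_eq0 -normr_eq0 -sqrf_eq0 sqr_normE.
  rewrite (fmorph_eq0 (real_complex R)) eq_le rdot_ge0 andbT.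
  have := lowA (S (A x) - x); rewrite linearB SK subrr {2}/rdot linear0l/=.
  by rewrite pmulr_rle0// exprn_gt0.
- exists c^-1 => y; rewrite norm_le_rdot ?invr_ge0 ?(ltW c0)//.
  by rewrite exprVn ler_pdivlMl ?exprn_gt0// -[in leRHS](SK y).
Qed.

(** The strict inequality in R[i] also asks the form to be real, which follows
from self-adjointness. *)
Lemma coercive_GLSp A :
  bounded_map A -> self_adjoint A -> coercive A -> GLSp H A.
Proof.
move=> bA sA cA; split=> //; last exact: coercive_isomorphism.
case: cA => c c0 cA x x1; rewrite ltcE; apply/andP; split.
  have : inner (A x) x = (inner (A x) x)^*%C by rewrite -innerC sA.
  by case: (inner _ _) => a b [] /=; lra.
apply: lt_le_trans (cA x).
by rewrite mulr_gt0//= -ltcR -sqr_normE x1 expr1n ltr01.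
Qed.

(** * Linear combinations *)

Lemma bounded_map_comb (f g : H -> H) (a b : R[i]) :
  bounded_map f -> bounded_map g -> bounded_map (fun x => a *: f x + b *: g x).
Proof.
move=> [M hM] [N hN].
have nR (z : R[i]) : `|z| = (complex.Re `|z|)%:C by rewrite RRe_real// normr_real.
exists (complex.Re `|a| * M + complex.Re `|b| * N) => x.
have -> : (complex.Re `|a| * M + complex.Re `|b| * N)%:C = `|a| * M%:C + `|b| * N%:C.
  by rewrite {2}(nR a) {2}(nR b) -!rmorphM -rmorphD.
rewrite (le_trans (ler_normD _ _))// !normrZ mulrDl -!mulrA.
by apply: lerD; apply: ler_wpM2l.
Qed.

Lemma self_adjoint_comb A B (a b : R) : self_adjoint A -> self_adjoint B ->
  self_adjoint (a%:C \*: A \+ b%:C \*: B).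
Proof.
move=> sA sB x y /=; rewrite linearDl linearDr.
rewrite !linearZl_LR !linearZr_LR /= sA sB.
by rewrite !conj_Creal//; exact/complex_realP/ex_intro.
Qed.

End Forms.

Theorem theorem3p2 (R : realType) (H : complexHilbertType R)
    (L T : {linear H -> H}) (hL : GLSp H L) (hT : GLSp H T)
    (t : R) (ht : 0 <= t <= 1) :
  GLSp H (t%:C \*: L \+ (1 - t)%:C \*: T).
Proof.
have [c c0 cL] := GLSp_coercive hL; have [d d0 dT] := GLSp_coercive hT.
case: hL hT => [bL sL _ _] [bT sT _ _].
apply: coercive_GLSp; [exact: bounded_map_comb|exact: self_adjoint_comb|].
case/andP: ht => t0 t1.
exists (Num.min c d) => [|x]; first by rewrite lt_min c0.
have mc : Num.min c d <= c by rewrite ge_min lexx.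
have md : Num.min c d <= d by rewrite ge_min lexx orbT.
rewrite rdotDl !rdotZl.
have hL : Num.min c d * rdot x x <= rdot (L x) x.
  by apply: le_trans (cL x); rewrite ler_wpM2r ?rdot_ge0.
have hT : Num.min c d * rdot x x <= rdot (T x) x.
  by apply: le_trans (dT x); rewrite ler_wpM2r ?rdot_ge0.
nra.
Qed.
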